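(* Let $\mathbf{m}=(m_1,\dots,m_n)$ be a nonzero sequence of nonnegative integers with $m_n=0$, and define $p=\max\{j\in\{1,\dots,n\} : m_j\neq 0\}$. The intersection complex $\Delta=\mathfrak{I}(\mathbf{m})$ is PR with degree type $(d_p,\dots,d_1)$, where for each $1\le i\le p$, $$d_i=\sum_{j=0}^{n-i-1}\binom{n-i-1}{j}m_{i+j}.$$
   Context: Write $[n]=\{1,\dots,n\}$. Intersection complexes: for a sequence $\mathbf{m}=(m_1,\dots,m_n)$ of nonnegative integers, $\mathfrak{I}(\mathbf{m})$ is the simplicial complex whose vertices are the symbols $v_S^r$ where $S$ is a nonempty subset of $[n]$ and $1\le r\le m_{|S|}$, and which is generated by the sets $F_1,\dots,F_n$, where $F_j=\{v_S^r : S\subseteq[n],\ j\in S,\ 1\le r\le m_{|S|}\}$ (i.e. its faces are all subsets of the $F_j$). PR complexes: fix an arbitrary field $\mathbb{K}$. Simplicial complexes are finite and contain $\emptyset$; $\widetilde H_i(\Delta)$ denotes reduced simplicial homology with coefficients in $\mathbb{K}$, with $\widetilde H_{-1}(\{\emptyset\})=\mathbb{K}$. For $\sigma\in\Delta$, $\mathrm{link}_\Delta\sigma=\{\tau\in\Delta:\tau\cap\sigma=\emptyset,\ \tau\cup\sigma\in\Delta\}$. $\Delta$ is PR (over $\mathbb{K}$) if for every $i$ and all $\sigma,\tau\in\Delta$, $\widetilde H_i(\mathrm{link}_\Delta\sigma)\neq0\neq\widetilde H_i(\mathrm{link}_\Delta\tau)$ implies $|\sigma|=|\tau|$. Degree type: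 for a PR complex $\Delta$, let $p$ be the maximum index for which some face $\sigma$ has $\widetilde H_{p-1}(\mathrm{link}_\Delta\sigma)\neq0$; for $0\le i\le p$ let $s_i$ be the common size $|\sigma|$ of the faces $\sigma$ with $\widetilde H_{i-1}(\mathrm{link}_\Delta\sigma)\neq 0$ (such faces exist for each such $i$); for $1\le i\le p$ let $d_i=s_{i-1}-s_i$. The degree type of $\Delta$ is $(d_p,\dots,d_1)$. *)

(* Defs.v *)
From HB Require Import structures.
From mathcomp Require Import all_boot all_order all_algebra.

Set Implicit Arguments.
Unset Strict Implicit.
Unset Printing Implicit Defensive.

Import GRing.Theory.
Local Open Scope ring_scope.

Section Complexes.
Variable T : finType.
Implicit Types (D : {set {set T}}) (s : {set T}).

Definition simplicial_complex D : Prop :=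
  set0 \in D /\ forall s t : {set T}, t \subset s -> s \in D -> t \in D.

Definition link D s : {set {set T}} :=
  [set t in D | [disjoint t & s] & t :|: s \in D].

(* The faces are all subsets of the sets [F i]. *)
Definition generated_complex (I : finType) (F : I -> {set T}) :
    {set {set T}} :=
  [set s : {set T} | [exists i, s \subset F i]].

Lemma link_simplicial_complex D s :
  simplicial_complex D -> s \in D -> simplicial_complex (link D s).
Proof.
move=> [D0 Dsub] sD; split=> [|u t tu].
  by rewrite inE D0 set0U sD disjoints_subset sub0set.
rewrite !inE => /and3P[uD us uUD]; apply/and3P; split.
- exact: Dsub tu uD.
- exact: disjointWl tu us.
- exact: Dsub (setSU s tu) uUD.
Qed.

End Complexes.

Section ReducedHomology.
Variables (K : fieldType) (T : finType).

(* All chains, of all dimensions, live in the vector space with basis the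
   subsets of [T]; simplices are oriented by the enumeration of [T]. *)
Local Notation chain := {ffun {set T} -> K^o}.

Definition simplex (s : {set T}) : chain := [ffun t => (t == s)%:R].

Definition face_sign (s : {set T}) (v : T) : K :=
  (-1) ^+ #|[set u in s | (enum_rank u < enum_rank v)%N]|.

(* The augmented boundary: a vertex [set v] is sent to the empty simplex. *)
Definition boundary_fun (c : chain) : chain :=
  \sum_(s : {set T}) c s *: \sum_(v in s) face_sign s v *: simplex (s :\ v).

Fact boundary_fun_linear : linear boundary_fun.
Proof.
move=> a c d; rewrite /boundary_fun scaler_sumr -big_split /=.
by apply: eq_bigr => s _; rewrite !ffunE scalerDl scalerA.
Qed.
HB.instance Definition _ :=
  GRing.isLinear.Build K chain chain _ boundary_fun boundary_fun_linear.

Definition boundary : 'End(chain) := linfun boundary_fun.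

Variable D : {set {set T}}.

(* A face [s] has dimension #|s| - 1, so the empty face has dimension -1. *)
Definition chains (i : int) : {vspace chain} :=
  (\sum_(s in D | #|s|%:Z - 1 == i) <[simplex s]>)%VS.

Definition cycles (i : int) : {vspace chain} := (chains i :&: lker boundary)%VS.

Definition boundaries (i : int) : {vspace chain} :=
  (boundary @: chains (i + 1))%VS.

Definition is_boundary (i : int) : {pred subvs_of (cycles i)} :=
  [pred z | vsval z \in boundaries i].
Arguments is_boundary : clear implicits.

Fact is_boundary_zmod_closed i : zmod_closed (is_boundary i).
Proof.
split=> [|x y]; first exact: mem0v.
by rewrite !inE; apply: rpredB.
Qed.
HB.instance Definition _ i :=
  GRing.isZmodClosed.Build _ (is_boundary i) (is_boundary_zmod_closed i).

(* Reduced homology, as the quotient (additive) group of cycles modulo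
   boundaries. The library's [Quotient.quot] is the quotient of any additive
   group by a subgroup. *)
Definition reduced_homology (i : int) : zmodType :=
  Quotient.quot (is_boundary i).

Definition homology_neq0 (i : int) : Prop :=
  exists x : reduced_homology i, x != 0.

End ReducedHomology.

Section PR.
Variables (K : fieldType) (T : finType) (D : {set {set T}}).

Definition PR : Prop :=
  simplicial_complex D /\
  forall (i : int) (s t : {set T}), s \in D -> t \in D ->
    homology_neq0 K (link D s) i -> homology_neq0 K (link D t) i ->
    #|s| = #|t|.

Definition occurs (i : nat) (s : {set T}) : Prop :=
  s \in D /\ homology_neq0 K (link D s) (i%:Z - 1).

(* [d] is the list (d_p, ..., d_1); it is integer-valued so that the
   subtraction in d_i = s_(i-1) - s_i is not truncated. *)
Definition has_degree_type (d : seq int) : Prop :=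
  exists (p : nat) (sz : nat -> nat),
    [/\ (exists s, occurs p s) /\
          (forall i, (exists s, occurs i s) -> (i <= p)%N),
        forall i, (i <= p)%N ->
          (exists s, occurs i s) /\ (forall s, occurs i s -> #|s| = sz i)
      & d = [seq (sz i.-1)%:Z - (sz i)%:Z | i <- rev (iota 1 p)]].

End PR.

Section IntersectionComplex.
Variables (n : nat) (m : n.-tuple nat).

(* 1-based: [entry j] is m_j for 1 <= j <= n, and 0 for other j. *)
Definition entry (j : nat) : nat := nth 0%N (0%N :: m) j.

(* [n] is modelled by 'I_n; the vertex v_S^r is [Tagged _ (r - 1)]. *)
Definition vertex : finType :=
  {S : {S : {set 'I_n} | S != set0} & 'I_(entry #|val S|)}.

Definition intersection_facet (j : 'I_n) : {set vertex} :=
  [set v : vertex | j \in val (tag v)].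

Definition intersection_complex : {set {set vertex}} :=
  generated_complex intersection_facet.

End IntersectionComplex.

(* Main.v *)
Require Import Defs.
From HB Require Import structures.
From mathcomp Require Import all_boot all_order all_algebra.

Set Implicit Arguments.
Unset Strict Implicit.
Unset Printing Implicit Defensive.

Import GRing.Theory.

(** For a face [s] let [A] be the set of all [j] with [s] contained in the facet
    [F_j]; the link of [s] is generated by the sets [F_j \ s], [j] in [A].
    If some vertex [v_S^r] outside [s] has [S] containing [A], the link is a cone
    over it, hence acyclic. Otherwise [s] consists of all [v_S^r] with [S]
    containing [A], and a nonempty family of [F_j \ s], [j] in [B], has a common
    vertex iff [#|B| <= k], where [k = min(p, #|A| - 1)]. A Mayer-Vietoris
    induction on [#|A|], removing one generator at a time (the intersection with
    it is again such a family, with [k - 1]), shows that the homology lives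
    exactly in degree [k - 1]. Counting the [v_S^r] with [S] containing [A] gives
    the sizes [s_i], and Pascal's rule their differences. *)

(** * Reduced homology *)

Section Homology.
Local Open Scope ring_scope.
Local Open Scope quotient_scope.
Variables (K : fieldType) (T : finType).
Implicit Types (D : {set {set T}}) (s t : {set T}) (i : int).
Local Notation chain := {ffun {set T} -> K^o}.
Implicit Types c d : chain.
Local Notation "\d" := (@boundary_fun K T) (at level 0).
Local Notation sg := (@face_sign K T).

(** Support condition equivalent to membership in the subspace [chains K D i], so that chains can be
    handled coefficient by coefficient. *)
Definition chain_of D i c := forall s, c s != 0 -> s \in D /\ #|s|%:Z - 1 = i.

Lemma chain_sum c : c = \sum_s c s *: simplex K s.
Proof.
apply/ffunP=> t; rewrite sum_ffunE (bigD1 t) //= big1 => [|s nst].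
  by rewrite !ffunE eqxx addr0 [_ *: _]mulr1.
by rewrite !ffunE eq_sym (negPf nst) [_ *: _]mulr0.
Qed.

Lemma chainsP D i c : reflect (chain_of D i c) (c \in chains K D i).
Proof.
apply: (iffP idP) => [/memv_sumP[b bP ->] s|cP].
  rewrite sum_ffunE => nz.
  suff [t /andP[tD /eqP ti] nzt] : exists2 t, (t \in D) && (#|t|%:Z - 1 == i) & b t s != 0.
    have /vlineP[a bt] := bP t (introT andP (conj tD (introT eqP ti))).
    move: nzt; rewrite bt !ffunE.
    by case: (s =P t) => [-> //|_]; rewrite [_ *: _]mulr0 eqxx.
  case: (pickP [pred t | (t \in D) && (#|t|%:Z - 1 == i) & b t s != 0]) => [t /andP[]|b0].
    by exists t.
  case/eqP: nz; apply: big1 => t tD.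
  by have /= := b0 t; rewrite tD => /negbFE/eqP.
rewrite [c]chain_sum; apply: rpred_sum => s _.
have [->|/cP[sD /eqP si]] := eqVneq (c s) 0; first by rewrite scale0r mem0v.
apply: rpredZ; apply: subvP (memv_line _).
by apply: (sumv_sup s); rewrite ?sD.
Qed.

Lemma boundaryE c : boundary K T c = \d c.
Proof. exact: lfunE. Qed.

(** A class is nonzero iff its representative is not in the image of the boundary map; this trades
    the quotient group for an explicit non-bounding cycle. *)
Lemma homology_neq0P D i :
  homology_neq0 K D i <->
  exists c, [/\ chain_of D i c, \d c = 0 &
                forall d, chain_of D (i + 1) d -> \d d <> c].
Proof.
have bdP (x : subvs_of (cycles K D i)) :
    (\pi_(reduced_homology K D i) x != 0) = (vsval x \notin boundaries K D i).
  have <- : \pi_(reduced_homology K D i) 0 = 0 by exact: raddf0.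
  by rewrite -Quotient.idealrBE subr0.
split=> [[x]|[c [ci c0 cN]]].
  rewrite -[x]reprK bdP; set y := repr x => yN.
  have := subvsP y; rewrite memv_cap memv_ker boundaryE => /andP[/chainsP yi /eqP y0].
  exists (vsval y); split=> // d di dy; case/negP: yN.
  by rewrite -dy -boundaryE memv_img //; apply/chainsP.
have cZ : c \in cycles K D i.
  by rewrite memv_cap memv_ker boundaryE c0 eqxx andbT; apply/chainsP.
exists (\pi_(reduced_homology K D i) (Subvs cZ)); rewrite bdP /=.
by apply/negP=> /memv_imgP[d /chainsP di]; rewrite boundaryE => /esym; apply: cN.
Qed.

(** * Coefficients and signs of the boundary operator *)

Lemma boundary_coef c t :
  \d c t = \sum_(v | v \notin t) sg t v * c (v |: t).
Proof.
have sgU v : v \notin t -> sg (v |: t) v = sg t v.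
  move=> vt; congr (_ ^+ #|pred_of_set _|); apply/setP=> u; rewrite !inE.
  by case: (u =P v) => [->|]; rewrite ?ltnn ?andbF.
rewrite /boundary_fun sum_ffunE.
under eq_bigr => s _ do rewrite ffunE sum_ffunE scaler_sumr big_mkcond.
rewrite exchange_big [RHS]big_mkcond; apply: eq_bigr => v _ /=.
have [vt|vt] := boolP (v \in t).
  rewrite big1 // => s _; case: ifP => // vs; rewrite !ffunE.
  case: (t =P s :\ v) => [ts|_]; first by rewrite ts !inE eqxx in vt.
  by rewrite mulr0n !scaler0.
rewrite (bigD1 (v |: t)) //= setU11 big1 => [|s nst]; last first.
  case: ifP => // vs; rewrite !ffunE.
  case: (t =P s :\ v) => [ts|_]; first by rewrite ts setD1K ?eqxx in nst.
  by rewrite mulr0n !scaler0.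
by rewrite !ffunE setU1K // eqxx addr0 sgU // [_ *: (_ *: _)]mulrC [_ *: _]mulr1.
Qed.

Lemma face_signU1 t v w : v \notin t ->
  sg (v |: t) w = sg t w * (-1) ^+ (enum_rank v < enum_rank w)%N.
Proof.
move=> vt; rewrite /face_sign -exprD; congr (_ ^+ _).
rewrite [LHS](cardsD1 v) addnC !inE eqxx; congr (_ + _)%N; apply: eq_card => u.
by rewrite !inE; case: (u =P v) => [->|]; rewrite ?(negPf vt).
Qed.

Lemma face_signK t v : sg t v * sg t v = 1.
Proof. by rewrite -expr2 sqrr_sign. Qed.

(** Exactly one of [v], [w] comes first in the enumeration, so inserting it changes exactly one of
    the two inner signs. *)
Lemma face_sign_swap t v w : v \notin t -> w \notin t -> v != w ->
  sg t v * sg (v |: t) w = - (sg t w * sg (w |: t) v).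
Proof.
move=> vt wt vw; rewrite !face_signU1 // !mulrA [sg t w * _]mulrC.
have : enum_rank v != enum_rank w by rewrite (inj_eq enum_rank_inj).
by rewrite -val_eqE neq_ltn; case: ltngtP; rewrite //= expr0 expr1 ?mulrN1 ?opprK mulr1.
Qed.

Lemma boundary_boundary c : \d (\d c) = 0.
Proof.
apply/ffunP=> t; rewrite boundary_coef ffunE.
pose f v w := sg t v * sg (v |: t) w * c (v |: (w |: t)).
(* The coefficient at [t] is a sum over ordered pairs of distinct vertices outside [t]. Splitting on
   which vertex comes first and exchanging one of the two sums pairs [(v, w)] with [(w, v)], and
   these cancel. *)
transitivity (\sum_(v | v \notin t) \sum_(w | (w \notin t) && (w != v)) f v w).
  apply: eq_bigr => v vt; rewrite boundary_coef mulr_sumr.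
  apply: eq_big => [w|w _]; first by rewrite !inE negb_or andbC.
  by rewrite mulrA /f setUCA.
pose lt (v w : T) := (enum_rank v < enum_rank w)%N.
have split_lt v w : (w != v) = lt v w (+) lt w v.
  rewrite -(inj_eq enum_rank_inj) -val_eqE neq_ltn /lt.
  by case: ltngtP.
under eq_bigr => v _ do rewrite (bigID (lt v)) /=.
rewrite big_split /= [X in _ + X](exchange_big_dep (fun w => w \notin t)) /=; last first.
  by move=> v w _ /andP[/andP[]].
rewrite -big_split big1 //= => w wt.
rewrite [X in _ + X](eq_bigl (fun v => (v \notin t) && (v != w) && lt w v)) => [|v].
  rewrite -big_split big1 //= => v /andP[/andP[vt vw] _].
  by rewrite /f face_sign_swap 1?eq_sym // setUCA mulNr addNr.
rewrite wt eq_sym split_lt /= /lt; case: (v \notin t) => //=.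
by case: ltngtP.
Qed.

Lemma boundaryB c d : \d (c - d) = \d c - \d d.
Proof. by rewrite -!boundaryE raddfB. Qed.

Lemma chain_ofB D i c d : chain_of D i c -> chain_of D i d -> chain_of D i (c - d).
Proof. by move=> /chainsP cD /chainsP dD; apply/chainsP/rpredB. Qed.

Lemma chain_ofS D D' i c : D \subset D' -> chain_of D i c -> chain_of D' i c.
Proof. by move=> /subsetP DD' cD s /cD[/DD']. Qed.

Definition face_closed D := forall s t, t \subset s -> s \in D -> t \in D.

Lemma chain_of_boundary D i c :
  face_closed D -> chain_of D i c -> chain_of D (i - 1) (\d c).
Proof.
move=> Dsub cD t; rewrite boundary_coef => nz.
case: (pickP [pred v | (v \notin t) && (c (v |: t) != 0)]) => [v /andP[vt]|c0].
  case/cD=> vtD <-; split; first exact: Dsub (subsetUr _ _) vtD.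
  by rewrite cardsU1 vt PoszD [1 + _]addrC addrK.
case/eqP: nz; apply: big1 => v vt.
by have /= := c0 v; rewrite vt => /negbFE/eqP ->; rewrite mulr0.
Qed.

(** * Cones and acyclicity *)

Definition cone v c : chain :=
  [ffun t : {set T} => if v \in t then sg (t :\ v) v * c (t :\ v) else 0].

(** Contracting homotopy. At [t] without [v] only the insertion of [v] contributes; at [t]
    containing [v] the second summand gives [c t] plus terms that cancel the first by
    [face_sign_swap]. *)
Lemma boundary_cone v c : \d (cone v c) + cone v (\d c) = c.
Proof.
apply/ffunP=> t; rewrite !ffunE !boundary_coef.
have [vt|vt] := boolP (v \in t); last first.
  rewrite addr0 (bigD1 v) //= ffunE setU11 setU1K // mulrA face_signK mul1r.
  rewrite big1 ?addr0 // => w /andP[wt wv].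
  by rewrite ffunE !inE eq_sym (negPf wv) (negPf vt) mulr0.
rewrite mulr_sumr [X in _ + X](bigD1 v) /= ?setD11 //.
rewrite mulrA face_signK mul1r setD1K // addrCA.
rewrite [X in _ + (_ + X)](eq_bigl (fun w => w \notin t)) => [|w].
  rewrite -big_split big1 ?addr0 //= => w wt; rewrite ffunE !inE vt orbT.
  have wv : w != v by apply: contraNneq wt => ->.
  have -> : (w |: t) :\ v = w |: (t :\ v).
    by apply/setP=> u; rewrite !inE; case: (u =P v) => //= ->; rewrite eq_sym (negPf wv).
  rewrite !mulrA -{1}(setD1K vt) -mulrDl.
  have := @face_sign_swap (t :\ v) v w; rewrite !inE eqxx (negPf wt) andbF.
  rewrite eq_sym wv => /(_ isT isT isT) sw.
  rewrite -[sg (v |: _) w]mul1r -(face_signK (t :\ v) v) -[_ * _ * sg (v |: _) w]mulrA sw.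
  by rewrite mulrN mulNr -!mulrA face_signK mulr1 addNr mul0r.
rewrite !inE; case: (w =P v) => [->|]; rewrite ?vt //=.
by rewrite andbT.
Qed.

(** A cycle [c] is the boundary of [cone v c], and the hypothesis keeps this chain in [D]. *)
Lemma cone_acyclic D i v :
  (forall s, s \in D -> v |: s \in D) -> ~ homology_neq0 K D i.
Proof.
move=> vD /homology_neq0P[c [ci c0 cN]]; apply: (cN (cone v c)); last first.
  rewrite -[RHS](boundary_cone v) c0.
  have -> : cone v 0 = 0; last by rewrite addr0.
  by apply/ffunP=> t; rewrite !ffunE mulr0 if_same.
move=> t; rewrite ffunE; case: ifP => [vt|]; last by rewrite eqxx.
rewrite mulf_eq0 negb_or => /andP[_ /ci[tD <-]]; split.
  by rewrite -(setD1K vt) vD.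
by rewrite (cardsD1 v t) vt PoszD subrK [_ + Posz #|_|]addrC addrK.
Qed.

(** Membership in the subspace of boundaries is decidable, so vanishing homology yields an actual
    preimage. *)
Lemma acyclic_lift D i c :
  ~ homology_neq0 K D i -> chain_of D i c -> \d c = 0 ->
  exists2 d, chain_of D (i + 1) d & \d d = c.
Proof.
move=> DN ci c0; have [/memv_imgP[d /chainsP di ->]|cN] := boolP (c \in boundaries K D i).
  by exists d; rewrite ?boundaryE.
case: DN; apply/homology_neq0P; exists c; split=> // d /chainsP di dc.
by case/negP: cN; rewrite -dc -boundaryE memv_img.
Qed.

(** * Two pieces of the Mayer-Vietoris sequence *)

Section MayerVietoris.
Variables (D D' : {set {set T}}).
Hypotheses (clD : face_closed D) (clD' : face_closed D').

Let split_chain i c : chain_of (D :|: D') i c ->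
  exists x y, [/\ chain_of D i x, chain_of D' i y & c = x - y].
Proof.
(* Simplices in [D] go to [x]; the others lie in [D'] and go to [y] with the opposite sign. *)
move=> ci; pose x : chain := [ffun s : {set T} => if s \in D then c s else 0].
exists x, (x - c); split; last by rewrite subKr.
  by move=> s; rewrite ffunE; case: ifP => [sD /ci[]|_ /eqP].
move=> s; rewrite !ffunE; case: ifP => [|sD]; first by rewrite subrr eqxx.
by rewrite sub0r oppr_eq0 => /ci; rewrite inE sD.
Qed.

Let chain_ofI i c : chain_of D i c -> chain_of D' i c -> chain_of (D :&: D') i c.
Proof. by move=> cD cD' s nz; rewrite inE; have [-> ->] := cD s nz; have [->] := cD' s nz. Qed.

(** Exactness at the homology of the union. For a cycle [x - y] the common boundary of [x] and [y]
    bounds some [t] in the intersection; then [x - t] and [y - t] are cycles, which bound in [D] and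
    in [D']. *)
Lemma Mayer_Vietoris_acyclic i :
  ~ homology_neq0 K D i -> ~ homology_neq0 K D' i ->
  ~ homology_neq0 K (D :&: D') (i - 1) -> ~ homology_neq0 K (D :|: D') i.
Proof.
move=> DN D'N IN /homology_neq0P[_ [/split_chain[x [y [xi yi ->]]]]].
rewrite boundaryB => /eqP; rewrite subr_eq0 => /eqP xy /=.
have zi : chain_of (D :&: D') (i - 1) (\d x).
  by apply: chain_ofI; last rewrite xy; apply: chain_of_boundary.
have [t] := acyclic_lift IN zi (boundary_boundary x).
rewrite subrK => ti tx.
have [] := @acyclic_lift D i (x - t) DN.
- by apply: chain_ofB => //; apply: chain_ofS ti; apply: subsetIl.
- by rewrite boundaryB tx subrr.
move=> u ui ux; have [] := @acyclic_lift D' i (y - t) D'N.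
- by apply: chain_ofB => //; apply: chain_ofS ti; apply: subsetIr.
- by rewrite boundaryB tx xy subrr.
move=> w wi wy; move/(_ (u - w)); case; last by rewrite boundaryB ux wy opprB addrA subrK.
apply: chain_ofB; [apply: chain_ofS ui | apply: chain_ofS wi].
  exact: subsetUl.
exact: subsetUr.
Qed.

(** Exactness at the homology of the intersection. A non-bounding cycle there bounds [x] in [D] and
    [y] in [D'], and [x - y] is the required cycle of the union. *)
Lemma Mayer_Vietoris_neq0 i :
  ~ homology_neq0 K D (i - 1) -> ~ homology_neq0 K D' (i - 1) ->
  homology_neq0 K (D :&: D') (i - 1) -> homology_neq0 K (D :|: D') i.
Proof.
move=> DN D'N /homology_neq0P[z [zi z0 zN]].
have [] := acyclic_lift DN (chain_ofS (subsetIl _ _) zi) z0.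
have [] := acyclic_lift D'N (chain_ofS (subsetIr _ _) zi) z0.
rewrite subrK => y yi yz x xi xz.
apply/homology_neq0P; exists (x - y); split.
- apply: chain_ofB; [apply: chain_ofS xi | apply: chain_ofS yi].
    exact: subsetUl.
  exact: subsetUr.
- by rewrite boundaryB xz yz subrr.
(* If [x - y] were the boundary of [u - w], then [x - \d u = y - \d w] would lie in both complexes
   and have boundary [z], against the choice of [z]. *)
move=> _ /split_chain[u [w [ui wi ->]]]; rewrite boundaryB => uwxy.
have xu : x - \d u = y - \d w.
  apply/eqP; rewrite -subr_eq0 opprB [\d w - y]addrC addrACA -uwxy.
  by rewrite [- _ + _]addrC -[X in _ + X]opprB subrr.
apply: (zN (x - \d u)); last by rewrite boundaryB boundary_boundary xz subr0.
rewrite subrK; apply: chain_ofI; last rewrite xu.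
  by apply: chain_ofB => //; rewrite -[i](addrK 1); apply: chain_of_boundary.
by apply: chain_ofB => //; rewrite -[i](addrK 1); apply: chain_of_boundary.
Qed.

End MayerVietoris.

(** * Complexes generated by a finite family of simplices *)

Section SimplexSkeletonNerve.
Variable I : finType.
Implicit Types (A B : {set I}) (G : I -> {set T}).

(** The index set is an argument so that an induction can drop generators; for empty [A] not even
    the empty face remains. *)
Definition generated_on A G : {set {set T}} :=
  [set s : {set T} | [exists j in A, s \subset G j]].

Lemma generated_onP A G s :
  reflect (exists2 j, j \in A & s \subset G j) (s \in generated_on A G).
Proof. by rewrite inE; apply: exists_inP. Qed.

Lemma generated_on_closed A G : face_closed (generated_on A G).
Proof.
move=> s t ts /generated_onP[j jA sj]; apply/generated_onP.
by exists j => //; apply: subset_trans sj.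
Qed.

Lemma generated_on_cone A G i v :
  (forall j, j \in A -> v \in G j) -> ~ homology_neq0 K (generated_on A G) i.
Proof.
move=> vA; apply: (@cone_acyclic _ _ v) => s /generated_onP[j jA sj].
by apply/generated_onP; exists j; rewrite // subUset sub1set vA.
Qed.

Lemma homology_empty_simplex i : homology_neq0 K [set set0 : {set T}] i <-> i = -1.
Proof.
split=> [/homology_neq0P[c [ci c0 cN]]|->].
  case: (pickP [pred s | c s != 0]) => [s /= /ci[]|cz].
    by rewrite inE => /eqP-> <-; rewrite cards0.
  case: (cN 0); first by move=> s; rewrite ffunE eqxx.
  rewrite -boundaryE linear0; apply/ffunP=> s; rewrite ffunE.
  by have /= /negbFE/eqP := cz s.
apply/homology_neq0P; exists (simplex K set0); split.
- move=> s; rewrite ffunE inE; case: (s =P set0) => [->|]; first by rewrite cards0.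
  by rewrite eqxx.
- apply/ffunP=> t; rewrite boundary_coef ffunE big1 // => v _; rewrite ffunE.
  by case: eqP => [/setP/(_ v)|]; rewrite ?mulr0 // !inE eqxx.
move=> d d0.
have -> : d = 0.
  apply/ffunP=> s; rewrite ffunE; apply/eqP/negPn/negP=> /d0[].
  by rewrite inE => /eqP->; rewrite cards0.
rewrite -boundaryE linear0 => /ffunP/(_ set0); rewrite !ffunE eqxx => /eqP.
by rewrite eq_sym oner_eq0.
Qed.

(* The nerve of the [G j], [j] in [A], is the [(k - 1)]-skeleton of a simplex. *)
Lemma homology_skeleton_nerve A G k i :
  (k < #|A|)%N ->
  (forall B, B != set0 -> B \subset A ->
     (\bigcap_(j in B) G j != set0) = (#|B| <= k)%N) ->
  homology_neq0 K (generated_on A G) i <-> i = k%:Z - 1.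
Proof.
have [a] := ubnP #|A|; elim: a A G k i => // a IH A G k i /ltnSE Aa kA capA.
have [k0|kpos] := posnP k.
  have [j jA] : exists j, j \in A by apply/card_gt0P; rewrite (leq_trans _ kA).
  (* For [k = 0] the singleton [[set l]] already exceeds the bound, so every generator is empty. *)
  have G0 l : l \in A -> G l = set0.
    move=> lA; have := capA [set l]; rewrite cards1 k0 big_set1 sub1set lA.
    rewrite -card_gt0 cards1 => /(_ isT isT).
    by rewrite -[RHS]/false => /negbFE/eqP.
  have -> : generated_on A G = [set set0].
    apply/setP=> s; rewrite [RHS]inE; apply/generated_onP/eqP => [[l lA]|->].
      by rewrite G0 // subset0 => /eqP.
    by exists j => //; apply: sub0set.
  by rewrite k0 sub0r; apply: homology_empty_simplex.
have [j jA] : exists j, j \in A by apply/card_gt0P; rewrite (leq_trans _ kA).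
have [v vj] : exists v, v \in G j.
  have := capA [set j]; rewrite cards1 kpos big_set1 sub1set jA -card_gt0 cards1.
  by move=> /(_ isT isT) /set0Pn.
pose A' := A :\ j; have cA : #|A| = #|A'|.+1 by rewrite (cardsD1 j) jA.
have DU : generated_on A G = generated_on A' G :|: powerset (G j).
  apply/setP=> s; rewrite [RHS]inE powersetE; apply/generated_onP/orP.
    case=> l lA sl; have [<-|lj] := eqVneq l j; [by right | left].
    by apply/generated_onP; exists l; rewrite // !inE lj.
  by case=> [/generated_onP[l /setD1P[_ lA] sl]|sj]; [exists l | exists j].
have DI : generated_on A' G :&: powerset (G j) = generated_on A' (fun l => G l :&: G j).
  apply/setP=> s; rewrite inE powersetE.
  apply/andP/generated_onP => [[/generated_onP[l lA sl] sj]|[l lA]].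
    by exists l; rewrite // subsetI sl.
  by rewrite subsetI => /andP[sl sj]; split=> //; apply/generated_onP; exists l.
(* Without [j] the family either still has more than [k] members, and induction applies, or has
   exactly [k], which then share a vertex and generate a cone. *)
have H' q : homology_neq0 K (generated_on A' G) q -> q = k%:Z - 1.
  have [ka|ka] := ltnP k #|A'|.
    apply: (proj1 (IH _ _ _ _ _ ka _)); first by rewrite -cA.
    by move=> B B0 BA; apply: capA => //; apply: subset_trans BA (subsetDl _ _).
  have Ak : #|A'| = k by apply/eqP; rewrite eqn_leq ka -ltnS -cA kA.
  have := capA A'; rewrite Ak leqnn subsetDl -card_gt0 Ak => /(_ kpos isT) /set0Pn[w].
  by move=> /bigcapP wA' /(generated_on_cone wA').
(* The sets [G l :&: G j] for [l] in [B] meet iff the [G l] for [l] in [j |: B] do, so the bound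
   drops to [k - 1]. *)
have HI q : homology_neq0 K (generated_on A' G :&: powerset (G j)) q <-> q = k.-1%:Z - 1.
  rewrite DI; apply: IH; first by rewrite -cA.
    by rewrite -ltnS prednK // -cA.
  move=> B B0 BA.
  have jB : j \notin B by apply/negP=> /(subsetP BA); rewrite !inE eqxx.
  (* The [1] becomes the truth value of [j \notin B], so that [cardsU1] produces the cardinal of
     [j |: B]. *)
  rewrite -ltnS prednK // -add1n -[1%N]/(true : nat) -jB -cardsU1 -capA.
  - rewrite big_setU1 //= setIC.
    congr (_ != _); have [l lB] := set0Pn _ B0.
    apply/setP=> w; rewrite inE; apply/bigcapP/andP.
      move=> wB; split; last by have /setIP[] := wB l lB.
      by apply/bigcapP=> r /wB/setIP[].
    by case=> /bigcapP wB wj r /wB; rewrite inE wj => ->.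
  - by apply/set0Pn; exists j; rewrite setU11.
  by rewrite subUset sub1set jA (subset_trans BA) ?subsetDl.
have HP q : ~ homology_neq0 K (powerset (G j)) q.
  apply: (@cone_acyclic _ _ v) => s; rewrite !powersetE => sj.
  by rewrite subUset sub1set vj.
have cl := @generated_on_closed A' G.
have clP : face_closed (powerset (G j)).
  by move=> s t ts; rewrite !powersetE; apply: subset_trans.
have kk : k.-1%:Z - 1 = k%:Z - 1 - 1 by rewrite -[in RHS](prednK kpos) -addn1 PoszD addrK.
(* The simplex on [G j] is acyclic, [A'] contributes at most in degree [k - 1], and the intersection
   exactly in degree [k - 2], which Mayer-Vietoris shifts to [k - 1]. *)
rewrite DU; split=> [|->].
  have [//|ik] := eqVneq i (k%:Z - 1) => /(Mayer_Vietoris_acyclic cl clP); case=> //.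
    by move/H'/eqP; rewrite (negPf ik).
  by move=> /HI /eqP; rewrite kk (inj_eq (addIr _)) (negPf ik).
apply: Mayer_Vietoris_neq0 => //; last by apply/HI.
by move/H'/eqP; rewrite -subr_eq0 addrAC subrr.
Qed.

End SimplexSkeletonNerve.

End Homology.

(** Used to enlarge a set to size [p] while avoiding a chosen element; the enlarged set carries a
    vertex because [entry m p] is positive. *)
Lemma subset_between (T : finType) (B C : {set T}) (k : nat) :
  B \subset C -> #|B| <= k <= #|C| ->
  exists S : {set T}, [/\ B \subset S, S \subset C & #|S| = k].
Proof.
move=> BC /andP[Bk kC].
have : 0 < #|[set D : {set T} | D \subset C :\: B & #|D| == k - #|B|]|.
  by rewrite cards_draws bin_gt0 cardsD (setIidPr BC) leq_sub2r.
case/card_gt0P=> D; rewrite inE subsetD => /andP[/andP[DC dDB] /eqP cD].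
exists (B :|: D); split; first exact: subsetUl.
  by rewrite subUset BC.
move: dDB; rewrite disjoint_sym -leq_card_setU => /eqP ->.
by rewrite cD subnKC.
Qed.

(** * Links in the intersection complex *)

Section IntersectionComplexes.
Variables (K : fieldType) (n : nat) (m : n.-tuple nat).
Local Notation Delta := (intersection_complex m).
Local Notation facet := (@intersection_facet n m).
Implicit Types (A B S : {set 'I_n}) (s : {set vertex m}).

Definition common s : {set 'I_n} := [set j | s \subset facet j].

(** Not the topological star, but the intersection of the facets indexed by [A]. It forms a Galois
    connection with [common]: [s \subset star A] iff [A \subset common s]. *)
Definition star A : {set vertex m} := [set v : vertex m | A \subset val (tag v)].

(** Counts the vertices over a set of size [a] by the number [j] of further elements in their
    support. *)
Definition star_size a := \sum_(0 <= j < (n - a).+1) 'C(n - a, j) * entry m (a + j).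

Lemma mem_intersection_complex s : (s \in Delta) = (common s != set0).
Proof.
rewrite inE; apply/existsP/set0Pn => -[j]; first by exists j; rewrite inE.
by rewrite inE; exists j.
Qed.

Lemma intersection_complex_simplicial : 0 < n -> simplicial_complex Delta.
Proof.
move=> n0; split.
  rewrite mem_intersection_complex; apply/set0Pn; exists (Ordinal n0).
  by rewrite inE sub0set.
move=> s t ts; rewrite !mem_intersection_complex => /set0Pn[j].
by rewrite inE => sj; apply/set0Pn; exists j; rewrite inE (subset_trans ts).
Qed.

Lemma link_intersection_complex s :
  link Delta s = generated_on (common s) (fun j => facet j :\: s).
Proof.
apply/setP=> t; rewrite inE; apply/and3P/generated_onP.
  case=> _ dts; rewrite inE => /existsP[j]; rewrite subUset => /andP[tj sj].
  by exists j; rewrite ?inE // subsetD tj.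
case=> j; rewrite inE subsetD => sj /andP[tj dts]; split=> //.
  by rewrite inE; apply/existsP; exists j.
by rewrite inE; apply/existsP; exists j; rewrite subUset tj.
Qed.

Lemma sub_star_common s : s \subset star (common s).
Proof.
apply/subsetP=> v vs; rewrite inE; apply/subsetP=> j; rewrite inE => /subsetP/(_ v vs).
by rewrite inE.
Qed.

Lemma vertex_over S : 0 < entry m #|S| -> exists v : vertex m, val (tag v) = S.
Proof.
move=> eS; have S0 : S != set0 by apply: contraTneq eS => ->; rewrite cards0.
by exists (Tagged (fun S : {S | S != set0} => 'I_(entry m #|val S|))
  (Ordinal eS : 'I_(entry m #|val (Sub S S0 : {S | S != set0})|))).
Qed.

Lemma entry_vertex (v : vertex m) : 0 < entry m #|val (tag v)|.
Proof. by case: v => S r /=; apply: leq_ltn_trans (ltn_ord r). Qed.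

Lemma card_star A : A != set0 -> #|star A| = star_size #|A|.
Proof.
move=> A0.
have -> : #|star A| =
    \sum_(S : {S : {set 'I_n} | S != set0} | A \subset val S) entry m #|val S|.
  rewrite -sum1_card.
  transitivity (\sum_(v : vertex m | (A \subset val (tag v)) && true) 1).
    by apply: eq_bigl => v; rewrite inE andbT.
  rewrite -(sig_big_dep (fun S : {S : {set 'I_n} | S != set0} => A \subset val S)
    (fun _ => xpredT) (fun _ _ => 1)).
  by apply: eq_bigr => S _; rewrite sum1_card card_ord.
transitivity (\sum_(S : {set 'I_n} | A \subset S) entry m #|S|).
  rewrite [RHS](reindex_omap (val : {S : {set 'I_n} | S != set0} -> _) insub) => [|S AS]; last first.
    rewrite insubT //=; apply: contraNneq A0 => S0.
    by rewrite -subset0 -S0.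
  by apply: eq_bigl => S; rewrite valK eqxx andbT.
(* Each [S] over [A] is [A :|: B] for a unique [B] in the complement of [A]; the sum is then sorted
   by [#|B|]. *)
rewrite (reindex_onto (fun B => A :|: B) (fun S => S :\: A)) => [|S AS]; last first.
  by rewrite -{1}(setIidPr AS) setID.
rewrite (eq_bigl (fun B => B \subset ~: A)) => [|B]; last first.
  by rewrite subsetUl setDUl setDv set0U -disjoints_subset; apply/eqP/setDidPl.
rewrite /star_size big_mkord.
have cAC : #|~: A| = n - #|A| by rewrite cardsCs setCK card_ord.
rewrite (partition_big (fun B => inord #|B| : 'I_(n - #|A|).+1) xpredT) //=.
apply: eq_bigr => j _; rewrite -[X in 'C(X, _)]cAC -cards_draws -sum_nat_const.
apply: eq_big => [B|B /andP[BA /eqP <-]].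
  rewrite inE; case BA: (B \subset ~: A) => //=.
  by rewrite -val_eqE /= inordK // ltnS -cAC subset_leq_card.
rewrite inordK ?ltnS -?cAC ?subset_leq_card // cardsU disjoint_setI0 ?cards0 ?subn0 //.
by rewrite disjoint_sym disjoints_subset.
Qed.

(** * Homology of links and sizes of faces, with [p] the largest index of a nonzero entry *)

Section TopEntry.
Variable p : nat.
Hypothesis p_lt_n : p < n.
Hypotheses (entry_p : 0 < entry m p) (entry_top : forall j, 0 < entry m j -> j <= p).

Lemma card_vertex_support (v : vertex m) : #|val (tag v)| <= p.
Proof. exact/entry_top/entry_vertex. Qed.

Lemma star_size_top a : p < a -> star_size a = 0.
Proof.
move=> pa; rewrite /star_size big1 // => j _.
apply/eqP; rewrite muln_eq0; apply/orP; right.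
rewrite -leqn0 leqNgt; apply/negP=> /entry_top; apply/negP.
by rewrite -ltnNge (leq_trans pa) ?leq_addr.
Qed.

(** For [j] outside [A], a set of size [p] over [A] avoiding [j] carries a vertex of [star A] that
    is not in the facet of [j]. If [p < #|A| < n] the equality fails, since [star A] is then
    empty. *)
Lemma common_star A : (#|A| <= p) || (A == setT) -> common (star A) = A.
Proof.
move=> HA; apply/eqP; rewrite eqEsubset; apply/andP; split; last first.
  apply/subsetP=> j jA; rewrite inE; apply/subsetP=> v; rewrite !inE.
  by move/subsetP/(_ j jA).
apply/subsetP=> j; apply: contraTT => jA.
case/orP: HA => [Ap|/eqP AT]; last by rewrite AT inE in jA.
have [|| S [AS SC cS]] := @subset_between _ A (~: [set j]) p.
- by rewrite subsetC sub1set inE.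
- by rewrite Ap cardsCs setCK card_ord cards1 -ltnS subn1 prednK // (leq_trans _ p_lt_n).
have [v vS] : exists v : vertex m, val (tag v) = S by apply: vertex_over; rewrite cS.
rewrite inE; apply/subsetPn; exists v; rewrite inE vS //.
by apply/negP=> /(subsetP SC); rewrite !inE eqxx.
Qed.

Lemma homology_link s i : s \in Delta ->
  homology_neq0 K (link Delta s) i <->
  s = star (common s) /\ i = ((minn p #|common s|.-1)%:Z - 1)%R.
Proof.
rewrite mem_intersection_complex link_intersection_complex.
set A := common s => A0.
have [sA|sA] := eqVneq s (star A); last first.
  split=> [|[//]]; last by move/eqP: sA.
  have /subsetPn[v vA vs] : ~~ (star A \subset s).
    by apply: contra sA => As; rewrite eqEsubset sub_star_common.
  move/(@generated_on_cone _ _ _ _ _ _ v); case=> j jA; rewrite !inE vs /=.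
  by move: vA; rewrite inE => /subsetP; apply.
have cA : 0 < #|A| by rewrite card_gt0.
apply: (iff_trans (@homology_skeleton_nerve _ _ _ A _ (minn p #|A|.-1) _ _ _)).
- by rewrite gtn_min prednK ?leqnn ?orbT.
- move=> B B0 BA.
  rewrite leq_min; apply/set0Pn/andP => [[v /bigcapP vB]|[Bp BA1]].
    have [j jB] := set0Pn _ B0.
    have BS : B \subset val (tag v).
      by apply/subsetP=> l /vB; rewrite !inE => /andP[].
    have : v \notin star A by rewrite -sA; have := vB j jB; rewrite inE => /andP[].
    rewrite inE => AS; split.
      exact: leq_trans (subset_leq_card BS) (card_vertex_support v).
    rewrite -ltnS prednK //; apply: proper_card; rewrite properE BA.
    by apply: contra AS => /subset_trans; apply.
  (* Some [x] in [A] is outside [B]; a set of size [p] over [B] without [x] carries a vertex outside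
     [star A = s]. *)
  have /subsetPn[x xA xB] : ~~ (A \subset B).
    by apply/negP=> /subset_leq_card AB; rewrite -(prednK cA) ltnNge BA1 in AB.
  have [|| S [BS SC cS]] := @subset_between _ B (~: [set x]) p.
  + by rewrite subsetC sub1set inE.
  + by rewrite Bp cardsCs setCK card_ord cards1 -ltnS subn1 prednK // (leq_trans _ p_lt_n).
  have [v vS] : exists v : vertex m, val (tag v) = S by apply: vertex_over; rewrite cS.
  exists v; apply/bigcapP=> j jB; rewrite !inE vS (subsetP BS) // andbT sA inE vS.
  by apply/subsetPn; exists x => //; apply/negP=> /(subsetP SC); rewrite !inE eqxx.
by split=> [->|[]].
Qed.

(** If [#|common s| <= p] the minimum is [#|common s|.-1]; otherwise [s] is empty and both sides are
    0. *)
Lemma card_face s : s \in Delta -> s = star (common s) ->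
  #|s| = star_size (minn p #|common s|.-1).+1.
Proof.
rewrite mem_intersection_complex => A0 sA; rewrite {1}sA card_star //.
move: A0; rewrite -card_gt0; case: #|_| => // a _ /=.
by case: (leqP p a) => // pa; rewrite !star_size_top.
Qed.

Lemma occursE i s : occurs K Delta i s <->
  [/\ s \in Delta, s = star (common s) & i = minn p #|common s|.-1].
Proof.
split=> [[sD /(homology_link _ sD)[sA /addIr[]]]|[sD sA ->]] //.
by split=> //; apply/(homology_link _ sD).
Qed.

Lemma occurs_exists i : i <= p -> exists s, occurs K Delta i s.
Proof.
have n0 : 0 < n by apply: leq_trans p_lt_n.
move=> ip; suff [A [A0 AT iA]] : exists A,
    [/\ A != set0, (#|A| <= p) || (A == setT) & i = minn p #|A|.-1].
  by exists (star A); apply/occursE; rewrite mem_intersection_complex common_star.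
(* Index [p] is realised by [A = setT], whose star is empty as [p < n]; an index [i < p] by any [A]
   of size [i.+1]. *)
move: ip; rewrite leq_eqVlt => /orP[/eqP->|ip].
  exists setT; rewrite eqxx orbT -card_gt0 cardsT card_ord; split=> //.
  by apply/esym/minn_idPl; rewrite -ltnS prednK.
have [|| A [_ _ cA]] := @subset_between _ set0 [set: 'I_n] i.+1.
- exact: sub0set.
- by rewrite cards0 cardsT card_ord (leq_trans ip (ltnW p_lt_n)).
by exists A; rewrite -card_gt0 cA ip; split=> //; apply/esym/minn_idPr/ltnW.
Qed.

Lemma intersection_complex_PR : PR K Delta.
Proof.
split=> [|i s t sD tD]; first by apply/intersection_complex_simplicial/leq_trans/p_lt_n.
move=> /(homology_link _ sD)[sA ->] /(homology_link _ tD)[tA /addIr[st]].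
by rewrite !card_face // st.
Qed.

Lemma intersection_complex_degree_type : has_degree_type K Delta
  [seq ((star_size i)%:Z - (star_size i.+1)%:Z)%R | i <- rev (iota 1 p)].
Proof.
exists p, (fun i => star_size i.+1); split.
- split=> [|i [s /occursE[_ _ ->]]]; first exact: occurs_exists.
  exact: geq_minl.
- move=> i ip; split=> [|s /occursE[sD sA ->]]; first exact: occurs_exists.
  exact: card_face.
by apply/eq_in_map => i; rewrite mem_rev mem_iota => /andP[/prednK->].
Qed.

End TopEntry.

Lemma star_size_sub i : i < n ->
  ((star_size i)%:Z - (star_size i.+1)%:Z)%R =
  Posz (\sum_(0 <= j < (n - i - 1).+1) 'C(n - i - 1, j) * entry m (i + j)).
Proof.
move=> i_n; suff -> : star_size i =
    \sum_(0 <= j < (n - i - 1).+1) 'C(n - i - 1, j) * entry m (i + j) + star_size i.+1.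
  by rewrite PoszD addrK.
rewrite /star_size [n - i.+1]subnS -subn1; set q := n - i - 1.
have -> : n - i = q.+1 by rewrite /q subn1 prednK // subn_gt0.
(* The terms with [j = 0] agree. In the others Pascal's rule splits ['C(q.+1, j.+1)]: one half is
   the tail of the first sum, the other is [star_size i.+1]. *)
rewrite big_nat_recl // [X in _ = X + _]big_nat_recl // !bin0 -addnA; congr addn.
under eq_bigr do rewrite binS mulnDl.
rewrite big_split /= big_nat_recr //= bin_small // mul0n addn0; congr addn.
by apply: eq_bigr => j _; rewrite addSnnS.
Qed.

End IntersectionComplexes.

(** * The properties of [p] and the resulting degree type *)

Theorem theorem3p11 (K : fieldType) (n : nat) (m : n.-tuple nat) (p : nat)
    (m_neq0 : tval m <> nseq n 0%N)
    (mn0 : entry m n = 0%N)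
    (p_def : p = (\max_(1 <= j < n.+1 | entry m j != 0) j)%N) :
  PR K (intersection_complex m) /\
  has_degree_type K (intersection_complex m)
    [seq Posz (\sum_(0 <= j < (n - i - 1).+1)
                 'C(n - i - 1, j) * entry m (i + j))%N
    | i <- rev (iota 1 p)].
Proof.
have entry_top j : 0 < entry m j -> j <= p.
  case: j => // j ej; rewrite p_def; apply: leq_bigmax_seq; last by rewrite -lt0n.
  rewrite mem_index_iota ltnS /=; case: ltnP => // nj.
  by move: ej; rewrite /entry /= nth_default ?size_tuple.
have [j ej] : exists j, 0 < entry m j.+1.
  have [/hasP[x /(nthP 0)[j _ <-] ej]|/hasPn m0] := boolP (has (fun x => 0 < x) m).
    by exists j.
  case: m_neq0; apply: (@eq_from_nth _ 0); rewrite size_tuple ?size_nseq // => j jn.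
  rewrite nth_nseq jn; apply/eqP; rewrite -leqn0 leqNgt; apply: m0.
  by rewrite mem_nth ?size_tuple.
have p_gt0 : 0 < p by apply: leq_trans (entry_top _ ej).
have entry_p : 0 < entry m p.
  (* A maximum over a possibly empty range is 0 or attained; this disjunction passes through [maxn],
     and [p_gt0] excludes 0. *)
  suff : (p == 0) || (0 < entry m p) by rewrite -leqn0 leqNgt p_gt0.
  rewrite {p_gt0 entry_top}p_def.
  apply: (big_ind (fun x => (x == 0) || (0 < entry m x))) => // [x y xP yP|x].
    by rewrite /maxn; case: ifP.
  by rewrite lt0n => ->; rewrite orbT.
have p_lt_n : p < n.
  rewrite ltn_neqAle; apply/andP; split; first by apply: contraTneq entry_p => ->; rewrite mn0.
  by rewrite p_def; apply/bigmax_leqP_seq => k; rewrite mem_index_iota => /andP[].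
split; first exact (intersection_complex_PR K p_lt_n entry_p entry_top).
have := intersection_complex_degree_type K p_lt_n entry_p entry_top.
congr has_degree_type; apply/eq_in_map => i.
rewrite mem_rev mem_iota => /andP[_ ip]; apply: star_size_sub.
by apply: leq_ltn_trans p_lt_n; rewrite -ltnS -add1n.
Qed.
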